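(* Let $s,q,k$ be fixed positive integers with $s\geq 4$ and $k\geq \max \left\{\binom{s}{2}, 2q+1\right\}$, and let $$L=\binom{s}{2}(k-1)^{2-\binom{s}{2}}(k-2)(k-3)\cdots\left(k-\binom{s}{2}+1\right).$$ Then there is a constant $c>0$ such that for all sufficiently large integers $p$ there exists a $k$-edge-coloring of $K_n$ with $$n=\left(\frac{(s-2)\,p\,L^{1/\left(1-\binom{s}{2}\right)}}{(c+o(1))\left(\binom{s}{2}-2.1\right) \ln \left(pL^{1/\left(1-\binom{s}{2}\right)}\right)}\right)^{\left(\binom{s}{2}-2.1\right)/(s-2)}$$ containing neither a rainbow $K_s$ nor a $q$-colored $K_p$, where $o(1)$ denotes some function of $p$ (which may depend on the fixed $s,q,k$) tending to $0$ as $p\to\infty$.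
   Context: A $k$-edge-coloring of $K_n$ is a map $E(K_n)\to\{1,\dots,k\}$. An edge-colored graph is rainbow if all its edges have distinct colors, and $q$-colored if its edges are colored with at most $q$ distinct colors. The product $(k-2)(k-3)\cdots(k-\binom s2+1)$ runs over all integers from $k-2$ down to $k-\binom s2+1$. The quantity $n$ is a positive integer (the $o(1)$ term is understood as chosen so that this holds). *)

(* Defs.v *)
From mathcomp Require Import all_boot all_order all_algebra.
From mathcomp Require Import all_classical all_reals all_analysis.
Import Order.TTheory GRing.Theory Num.Theory.
Import numFieldNormedType.Exports.

Set Implicit Arguments.
Unset Strict Implicit.
Unset Printing Implicit Defensive.

Local Open Scope ring_scope.

Definition edge (n : nat) : finType := {e : {set 'I_n} | #|e| == 2%N}.

Definition edge_coloring (n k : nat) : finType := {ffun edge n -> 'I_k}.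

Definition clique_edges (n : nat) (S : {set 'I_n}) : {set edge n} :=
  [set e : edge n | val e \subset S].

Definition rainbow (n k : nat) (f : edge_coloring n k) (F : {set edge n}) :
  Prop := {in F &, injective f}.

Definition colored_with_at_most (n k : nat) (f : edge_coloring n k) (q : nat)
    (F : {set edge n}) : Prop := (#|f @: F| <= q)%N.

Definition has_rainbow_clique (n k : nat) (f : edge_coloring n k) (s : nat) :
  Prop := exists S : {set 'I_n}, #|S| = s /\ rainbow f (clique_edges S).

Definition has_colored_clique (n k : nat) (f : edge_coloring n k) (q p : nat) :
  Prop :=
  exists S : {set 'I_n}, #|S| = p /\ colored_with_at_most f q (clique_edges S).

(* The exponent 2 - 'C(s, 2) is an integer, negative as soon as s >= 4. *)
Definition L (R : realType) (s k : nat) : R :=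
  'C(s, 2)%:R * (k%:R - 1) ^ (2 - 'C(s, 2)%:Z)
  * \prod_(2 <= i < 'C(s, 2)) (k%:R - i%:R).

(* Main.v *)
Require Import Defs.
From mathcomp Require Import all_boot all_order all_algebra.
From mathcomp Require Import all_classical all_reals all_analysis.
From mathcomp Require Import ring lra zify.
Import Order.TTheory GRing.Theory Num.Theory.
Import numFieldNormedType.Exports.

(** Only the [q + 1 <= k] colours [0, ..., q] are used: colour [0] is common
    and the colours [1, ..., q] are rare.  With [b = 'C(s, 2)], a clique on [s]
    vertices that is rainbow has at most one edge of colour [0], so it contains
    a near-clique, that is [b - 1] of its edges, all of rare colours.  So it is
    enough that no near-clique is rare and that every set of [p] vertices sees
    all [q + 1] colours.

    Label every edge by a uniform element of ['I_N], reading the labels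
    [1, ..., q] as rare colours and the others as [0].  Take a maximal family
    [F0] of pairwise disjoint near-cliques with rare edges only, and recolour by
    [0] all the edges of these near-cliques.  By maximality no rare near-clique
    survives ([colouring_of_unmissed]).  If a [p]-set [T] has then lost the
    colour [i], let [F] consist of the members of [F0] sharing an edge with [T]:
    the edges of [F] are rare, and the edges of [T] outside [F] do not have
    label [i].  For a given [F] this has probability at most [(1 - 1/N)^C(p,2) w^|F|] with
    [w = (2q/N)^(b-1)] ([card_missed]).  At most [b p^2 n^(s-2)] near-cliques
    meet [T] ([card_touching]), and summing over all their subfamilies [F] gives
    [(1 - 1/N)^C(p,2) (1 + w)^(b p^2 n^(s-2))].  This sum over subfamilies
    handles the dependence between near-cliques at once, so a union bound over
    [T], [i] and [F] takes the place of the local lemma ([exists_unmissed]).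

    If [N^(b-2)] is a large multiple of [n^(s-2)], the factor [(1 + w)^...] costs
    at most a quarter of the exponent [p^2 / (2N)] gained in [(1 - 1/N)^C(p,2)],
    and what remains beats the [q n^p] choices of [(T, i)] as soon as [p] exceeds
    a multiple of [N (ln n + ln q)] ([union_bound_lt1]).  Hence, for [n] large, a
    colouring exists when [p >= C n^a ln n] for any fixed [a >= (s-2)/(b-2)] ([colouring_of_log_bound]).
    The theorem is the case [a = (s-2)/(b-2.1)]: the constant [c] absorbs [C] and
    the powers of [L], and [eps] absorbs the rounding of [n] to an integer. *)

Set Implicit Arguments.
Unset Strict Implicit.
Unset Printing Implicit Defensive.

Local Open Scope ring_scope.

(** * Near-cliques and how many of them meet a set of vertices *)

Lemma leq_card_bigcup (I T : finType) (P : pred I) (F : I -> {set T}) :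
  (#|\bigcup_(i | P i) F i|%SET <= \sum_(i | P i) #|F i|)%N.
Proof.
elim/big_rec2: _ => [|i m A _ leAm]; first by rewrite cards0.
by apply: leq_trans (leq_card_setU _ _) _; rewrite leq_add2l.
Qed.

Lemma bin_leq_expn (n p : nat) : ('C(n, p) <= n ^ p)%N.
Proof.
apply: (@leq_trans (n ^_ p)%N); first by rewrite -bin_ffact leq_pmulr // fact_gt0.
elim: p => [|p IHp]; first by rewrite ffactn0.
by rewrite ffactnSr expnSr leq_mul // leq_subr.
Qed.

Section Cliques.
Import boot.fintype boot.finset.
Variable n : nat.
Implicit Types S T : {set 'I_n}.

Lemma card_clique_edges S : #|clique_edges S| = 'C(#|S|, 2).
Proof.
rewrite -cards_draws -(card_imset _ val_inj).
apply: eq_card => A; rewrite !inE; apply/imsetP/idP.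
  by case=> e; rewrite inE => eS ->; rewrite eS (valP e).
by case/andP=> AS A2; exists (exist _ A A2); rewrite ?inE.
Qed.

Lemma clique_edgesS S T : S \subset T -> clique_edges S \subset clique_edges T.
Proof. by move=> ST; apply/subsetP=> e; rewrite !inE => /fintype.subset_trans; apply. Qed.

(** The edge sets of the graphs K_s minus one edge.  Unlike being rainbow,
    containing one of them in the rare colours is monotone: recolouring an edge
    by the common colour cannot create a new one. *)
Definition near_cliques (s : nat) : {set {set edge n}} :=
  [set A : {set edge n} | (#|A| == 'C(s, 2).-1) &&
           [exists S : {set 'I_n}, (#|S| == s) && (A \subset clique_edges S)]].

Lemma near_clique_neq0 s A : (3 <= s)%N -> A \in near_cliques s -> A != set0.
Proof.
move=> s3; rewrite inE => /andP[/eqP cA _].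
rewrite -card_gt0 cA.
have := leq_bin2l 2 s3; rewrite binS bin1 binn; lia.
Qed.

Definition touching (s : nat) T : {set {set edge n}} :=
  [set A in near_cliques s | A :&: clique_edges T != set0].

(** Such a set is determined by two of its vertices in [T] and a list of the
    [s - 2] other ones. *)
Lemma card_sets_meeting s T : (2 <= s)%N ->
  (#|[set S : {set 'I_n} | (#|S| == s) && (1 < #|S :&: T|)]|
     <= #|T| ^ 2 * n ^ (s - 2))%N.
Proof.
move=> s2.
pose h (x : ('I_n * 'I_n) * (s - 2).-tuple 'I_n) : {set 'I_n} :=
  x.1.1 |: (x.1.2 |: [set y in x.2]).
apply: (@leq_trans #|h @: (setX (setX T T) setT)|); last first.
  apply: leq_trans (leq_imset_card _ _) _.
  by rewrite !cardsX cardsT card_tuple card_ord expnS expn1.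
apply: subset_leq_card; apply/subsetP=> S; rewrite inE => /andP[/eqP cS].
case/card_gt1P => u [v [uST vST uv]].
move: uST vST; rewrite !inE => /andP[uS uT] /andP[vS vT].
have sz : size (enum (S :\ u :\ v)) == (s - 2)%N.
  rewrite -cardE; have := cardsD1 u S; have := cardsD1 v (S :\ u).
  by rewrite !inE uS vS eq_sym uv cS /=; lia.
apply/imsetP; exists ((u, v), Tuple sz); first by rewrite !inE uT vT.
apply/setP=> y; rewrite !inE mem_enum !inE.
by case: (eqVneq y u) => [->|_] /=; [|case: (eqVneq y v) => [->|_] /=].
Qed.

(** A near-clique that shares an edge with [T] spans an [s]-set with two
    vertices in [T], and each [s]-set carries ['C(s, 2)] near-cliques. *)
Lemma card_touching s T : (3 <= s)%N ->
  (#|touching s T| <= 'C(s, 2) * (#|T| ^ 2 * n ^ (s - 2)))%N.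
Proof.
move=> s3.
pose Ss := [set S : {set 'I_n} | (#|S| == s) && (1 < #|S :&: T|)%N].
pose sub S := [set A : {set edge n} | A \subset clique_edges S & #|A| == 'C(s, 2).-1].
have b0 : (0 < 'C(s, 2))%N by rewrite bin_gt0; lia.
apply: (@leq_trans #|\bigcup_(S in Ss) sub S|).
  apply: subset_leq_card; apply/subsetP=> A; rewrite !inE -andbA.
  case/and3P=> cA /existsP[S /andP[cS AS]] /set0Pn[e].
  rewrite !inE => /andP[eA eT]; apply/bigcupP; exists S; last by rewrite inE AS.
  rewrite inE cS /= -(eqP (valP e)); apply: subset_leq_card.
  rewrite subsetI eT andbT.
  by have := fintype.subsetP AS _ eA; rewrite inE.
apply: leq_trans (leq_card_bigcup _ _) _ => /=.
rewrite mulnC; apply: (@leq_trans (\sum_(S in Ss) 'C(s, 2))%N).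
  apply: leq_sum => S; rewrite inE => /andP[/eqP cS _].
  rewrite cards_draws card_clique_edges cS.
  by rewrite -[X in 'C(_, X)]subn1 bin_sub // bin1.
by rewrite sum_nat_const leq_mul2r card_sets_meeting ?orbT //; lia.
Qed.
End Cliques.

(** * Random labels and the union bound *)

Section Sampling.
Import boot.fintype boot.finset.
Variables (R : realType) (n s q N : nat).
Implicit Types (T : {set 'I_n}) (g : {ffun edge n -> 'I_N}).
Implicit Types (F : {set {set edge n}}) (i : 'I_q).

Definition rare g : {set edge n} := [set e | (0 < g e <= q)%N].

(** The event that recolouring the family [F] makes [T] lose the colour [i.+1]:
    the edges of [F] are rare, and all edges of [T] with label [i.+1] are among
    them.  The index [i : 'I_q] stands for [i.+1] because label [0] is common. *)
Definition missed T i F : {set {ffun edge n -> 'I_N}} :=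
  [set g | (cover F \subset rare g) &&
           [forall e in clique_edges T :\: cover F, val (g e) != i.+1]].

Definition matchings T : {set {set {set edge n}}} :=
  [set F : {set {set edge n}} | (F \subset touching s T) && trivIset F].

Lemma card_interval_le : (#|[pred x : 'I_N | (0 < x <= q)%N]| <= q)%N.
Proof.
rewrite cardE -(size_map val) -[leqRHS](size_iota 1).
apply: uniq_leq_size; first by rewrite map_inj_uniq ?enum_uniq //; apply: val_inj.
move=> _ /mapP[x + ->]; rewrite mem_enum mem_iota => /andP[x0 xq].
by rewrite x0 add1n ltnS.
Qed.

(** The identity that turns a union bound over all families of near-cliques into
    a single power. *)
Lemma sum_subsets (I : finType) (A : {set I}) (w : R) :
  \sum_(B in powerset A) w ^+ #|B| = (1 + w) ^+ #|A|.
Proof.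
rewrite -[X in _ ^+ X]sum1_card -prodrXr /=.
have -> : \prod_(e in A) (1 + w) ^+ 1 =
          \prod_(e : I) ((if e \in A then w else 0) + 1).
  by rewrite big_mkcond; apply: eq_bigr => e _; case: ifP; rewrite ?add0r // addrC.
rewrite bigA_distr big_mkcond; apply: eq_bigr => B _; rewrite powersetE.
case: ifP => [BA|/negbT/subsetPn[e eB eA]].
  rewrite -prodr_const big_mkcond; apply: eq_bigr => e _.
  by case: ifP => // /(fintype.subsetP BA) ->.
by rewrite (bigD1 e) //= eB (negPf eA) mul0r.
Qed.

(** The labels are independent, so the count is a product over the edges: the
    density is [q / N] on the edges of [F] and [1 - 1 / N] on the other edges
    of [T].  On the edges of [F] inside [T], [q / N] is bounded by
    [(1 - 1 / N) * (2 * q / N)], which lets the first factor run over all edges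
    of [T], whatever [F] is.  Disjointness of [F] makes its edges number
    ['C(s, 2).-1] per member. *)
Lemma card_missed T i F : (q < N)%N -> (2 <= N)%N -> F \in matchings T ->
  #|missed T i F|%:R <= N%:R ^+ #|edge n| *
    ((1 - N%:R^-1) ^+ #|clique_edges T| *
     ((2 * q%:R / N%:R) ^+ ('C(s, 2).-1) ) ^+ #|F|) :> R.
Proof.
move=> qN N2; rewrite inE => /andP[/fintype.subsetP FT tF].
have N0 : 0 < N%:R :> R by rewrite ltr0n; lia.
have iN : (i.+1 < N)%N by have := ltn_ord i; lia.
pose h (e : edge n) : pred 'I_N := fun x =>
  if e \in cover F then (0 < x <= q)%N
  else (e \in clique_edges T) ==> (x != Ordinal iN).
have -> : #|missed T i F| = #|family h|.
  apply: eq_card => g; rewrite inE; apply/andP/familyP.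
    case=> /fintype.subsetP Fr /forall_inP nor e; rewrite unfold_in /h.
    case: ifP => [/Fr|eF]; first by rewrite inE.
    by apply/implyP => eT; apply: nor; rewrite inE eF.
  move=> gh; split.
    by apply/fintype.subsetP => e eF; have := gh e; rewrite inE unfold_in /h eF.
  apply/forall_inP => e; rewrite inE => /andP[/negPf eF eT].
  by have := gh e; rewrite unfold_in /h eF eT.
rewrite card_family foldrE big_image /= natr_prod.
have -> : ((2 * q%:R / N%:R) ^+ ('C(s, 2).-1) ) ^+ #|F| =
          (2 * q%:R / N%:R) ^+ #|cover F| :> R.
  rewrite -exprM -(eqP tF) (eq_bigr (fun=> 'C(s, 2).-1)) ?sum_nat_const 1?mulnC //.
  by move=> A /FT; rewrite !inE -!andbA => /andP[/eqP].
rewrite -[in X in _ <= X * _]cardsT -!prodr_const [X in _ <= X * _]big_mkcond.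
rewrite [X in _ <= _ * (X * _)]big_mkcond [X in _ <= _ * (_ * X)]big_mkcond.
rewrite -!big_split /=; apply: ler_prod => e _; rewrite ler0n /= inE.
have Nv : 0 <= N%:R^-1 :> R by rewrite invr_ge0 ltW.
have NV2 : N%:R^-1 <= 2^-1 :> R by rewrite lef_pV2 ?posrE // ler_nat.
have q0 : 0 <= q%:R :> R by rewrite ler0n.
have NN : N%:R * N%:R^-1 = 1 :> R by rewrite divff ?gt_eqF.
case eF: (e \in cover F); last first.
  rewrite mulr1 (_ : #|_| = #|[pred x | (e \in clique_edges T) ==> (x != Ordinal iN)]|);
    last by apply: eq_card => x; rewrite [LHS]unfold_in /h eF.
  case eT: (e \in clique_edges T) => /=; last by rewrite mulr1 ler_nat -[leqRHS]card_ord max_card.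
  have := cardC1 (Ordinal iN); rewrite card_ord => hc.
  rewrite (_ : #|_| = N.-1) -?hc; last by apply: eq_card => x; rewrite !unfold_in.
  by rewrite hc mulrBr mulr1 NN -subn1 natrB //; lia.
rewrite (_ : #|_| = #|[pred x : 'I_N | (0 < x <= q)%N]|); last first.
  by apply: eq_card => x; rewrite [LHS]unfold_in /h eF.
apply: (@le_trans _ _ q%:R); first by rewrite ler_nat card_interval_le.
case: ifP => _.
  rewrite [leRHS](_ : _ = (N%:R * N%:R^-1) * (2 * q%:R * (1 - N%:R^-1))); last by ring.
  rewrite NN; nra.
rewrite [leRHS](_ : _ = (N%:R * N%:R^-1) * (2 * q%:R)); last by ring.
rewrite NN; nra.
Qed.

(** The union bound: the left-hand side bounds the sum of the densities of the
    events [missed T i F], with ['C(n, p) <= n ^ p] choices of [T], [q] of [i],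
    and the sum over [F] enlarged to all families of near-cliques meeting [T]. *)
Lemma exists_unmissed p : (q < N)%N -> (2 <= N)%N -> (3 <= s)%N ->
  q%:R * n%:R ^+ p * ((1 - N%:R^-1) ^+ 'C(p, 2) *
     (1 + (2 * q%:R / N%:R) ^+ ('C(s, 2).-1)) ^+ ('C(s, 2) * (p ^ 2 * n ^ (s - 2))))
    < 1 :> R ->
  exists g, forall T i F, #|T| = p -> F \in matchings T -> g \notin missed T i F.
Proof.
move=> qN N2 s3; set u := 1 - _; set w := _ ^+ _.-1 => small.
have N0 : 0 < N%:R :> R by rewrite ltr0n; lia.
have u0 : 0 <= u by rewrite subr_ge0 invf_le1 // ler1n; lia.
have w0 : 0 <= w by rewrite exprn_ge0 // divr_ge0 ?mulr_ge0 ?ler0n.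
pose Bad T i := \bigcup_(F in matchings T) missed T i F.
pose Ts := [set T : {set 'I_n} | #|T| == p].
case: (boolP [exists g, g \notin \bigcup_(T in Ts) \bigcup_(i in setT) Bad T i]).
  move=> /existsP[g gB]; exists g => T i F cT FT; apply: contra gB => gm.
  apply/bigcupP; exists T; first by rewrite inE cT.
  by apply/bigcupP; exists i => //; apply/bigcupP; exists F.
rewrite negb_exists => /forallP /= all_bad; exfalso.
have Z0 : 0 < N%:R ^+ #|edge n| :> R by rewrite exprn_gt0.
have : N%:R ^+ #|edge n| <= N%:R ^+ #|edge n| * (q%:R * n%:R ^+ p * (u ^+ 'C(p, 2) *
     (1 + w) ^+ ('C(s, 2) * (p ^ 2 * n ^ (s - 2))))) :> R.
  rewrite -natrX -{1}[N]card_ord -card_ffun -cardsT.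
  apply: (@le_trans _ _ (#|\bigcup_(T in Ts) \bigcup_(i in setT) Bad T i|%:R)).
    rewrite ler_nat; apply: subset_leq_card; apply/fintype.subsetP => g _.
    by have := all_bad g; rewrite negbK.
  apply: (@le_trans _ _ (\sum_(T in Ts) \sum_(i in [set: 'I_q]) \sum_(F in matchings T)
      (N ^ #|edge n|)%:R * (u ^+ 'C(p, 2) * w ^+ #|F|))).
    apply: le_trans (_ : (\sum_(T in Ts) #|\bigcup_(i in [set: 'I_q]) Bad T i|)%:R <= _).
      by rewrite ler_nat; apply: leq_card_bigcup.
    rewrite natr_sum; apply: ler_sum => T; rewrite inE => /eqP cT.
    apply: le_trans (_ : (\sum_(i in [set: 'I_q]) #|Bad T i|)%:R <= _).
      by rewrite ler_nat; apply: leq_card_bigcup.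
    rewrite natr_sum; apply: ler_sum => i _.
    apply: le_trans (_ : (\sum_(F in matchings T) #|missed T i F|)%:R <= _).
      by rewrite ler_nat; apply: leq_card_bigcup.
    rewrite natr_sum; apply: ler_sum => F FT.
    by rewrite natrX -cT -card_clique_edges; apply: card_missed.
  apply: (@le_trans _ _ (\sum_(T in Ts) \sum_(i in [set: 'I_q])
     (N ^ #|edge n|)%:R * (u ^+ 'C(p, 2) *
     (1 + w) ^+ ('C(s, 2) * (p ^ 2 * n ^ (s - 2)))))).
    apply: ler_sum => T; rewrite inE => /eqP cT; apply: ler_sum => i _.
    rewrite -!big_distrr /= ler_wpM2l ?ler0n // ler_wpM2l ?exprn_ge0 //.
    apply: (@le_trans _ _ (\sum_(F in powerset (touching s T)) w ^+ #|F|)).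
      rewrite [leLHS]big_mkcond [leRHS]big_mkcond; apply: ler_sum => F _.
      rewrite inE powersetE; case: (F \subset _) => //=.
      by case: ifP => _ //; rewrite exprn_ge0.
    rewrite sum_subsets ler_weXn2l ?lerDl //.
    by rewrite -cT card_touching.
  set a := u ^+ _ * _; have a0 : 0 <= a by rewrite mulr_ge0 ?exprn_ge0 // addr_ge0.
  rewrite !sumr_const cardsT card_ord -mulrnA -[leLHS]mulr_natr cardsT !natrX.
  rewrite -[leLHS]mulrA ler_wpM2l ?(ltW Z0) // [leLHS]mulrC ler_wpM2r // natrM -natrX.
  rewrite ler_wpM2l ?ler0n // ler_nat.
  have := card_draws 'I_n p; rewrite card_ord => cTs.
  by apply: leq_trans (bin_leq_expn _ _); rewrite -cTs.
rewrite -[X in X <= _]mulr1 ler_pM2l // => /(lt_le_trans small).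
by rewrite ltxx.
Qed.
End Sampling.

(** * Recolouring a maximal disjoint family of near-cliques *)

Section Recolouring.
Import boot.fintype boot.finset.

Lemma exists_subset_card (I : finType) (A : {set I}) (m : nat) :
  (m <= #|A|)%N -> exists2 B : {set I}, B \subset A & #|B| = m.
Proof.
rewrite -bin_gt0 -cards_draws card_gt0 => /set0Pn[B].
by rewrite inE => /andP[BA /eqP cB]; exists B.
Qed.

(** The maximal family [F0] is disjoint, rather than made of all rare
    near-cliques, so that its part meeting [T] is one of the [F] in the
    hypothesis; maximality is still enough to leave no rare near-clique. *)
Lemma colouring_of_unmissed (n s q k p N : nat) (g : {ffun edge n -> 'I_N}) :
  (3 <= s)%N -> (s <= p)%N -> (q < k)%N ->
  (forall (T : {set 'I_n}) (i : 'I_q) F, #|T| = p -> F \in matchings s T ->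
     g \notin missed N T i F) ->
  exists f : edge_coloring n k,
    ~ has_rainbow_clique f s /\ ~ has_colored_clique f q p.
Proof.
move=> s3 sp qk unm; case: k qk => // k qk.
pose P (F : {set {set edge n}}) :=
  [&& F \subset near_cliques n s, trivIset F & cover F \subset rare q g].
have P0 : P set0.
  rewrite /P sub0set /cover !big_set0 sub0set andbT /=.
  by apply/trivIsetP => A B; rewrite inE.
have [F0 /maxsetP[/and3P[F0c /[dup] tF0 /trivIsetP dF0 F0r] F0max] _] := maxset_exists P0.
pose G := rare q g :\: cover F0.
(* [G] is the set of edges that keep their rare colour.  A near-clique inside
   [G] would be disjoint from [F0], hence in [F0] by maximality, hence outside
   [G]. *)
have free A : A \in near_cliques n s -> ~~ (A \subset G).
  move=> Ac; apply/negP => AG.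
  have AF0 B : B \in F0 -> [disjoint A & B].
    move=> BF0; rewrite disjoint_subset; apply/fintype.subsetP => e /(fintype.subsetP AG).
    rewrite !inE => /andP[+ _]; apply: contra => eB.
    by apply/bigcupP; exists B.
  have AF : A \in F0.
    have PA : P (A |: F0).
      rewrite /P finset.subUset sub1set Ac F0c /=; apply/andP; split.
        apply/trivIsetP => B C; rewrite !inE.
        case/predU1P => [->|BF] /predU1P[->|CF]; rewrite ?eqxx //; last exact: dF0.
          by move=> _; apply: AF0.
        by move=> _; rewrite disjoint_sym; apply: AF0.
      apply/bigcupsP => B; rewrite !inE => /predU1P[->|BF].
        by apply: fintype.subset_trans AG _; rewrite finset.subDset finset.subsetUr.
      by apply: fintype.subset_trans F0r; apply: bigcup_sup.
    by rewrite -(F0max _ PA (finset.subsetUr _ _)) !inE eqxx.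
  have /set0Pn[e eA] := near_clique_neq0 s3 Ac.
  have := fintype.subsetP AG _ eA; rewrite inE => /andP[/negP eF0 _]; apply: eF0.
  by apply/bigcupP; exists A.
(* Fewer than two edges outside [G] would leave a near-clique inside [G]. *)
have many0 (S : {set 'I_n}) : #|S| = s -> (1 < #|clique_edges S :\: G|)%N.
  move=> cS; rewrite ltnNge; apply/negP => few.
  have : ('C(s, 2).-1 <= #|clique_edges S :&: G|)%N.
    have := cardsID G (clique_edges S); rewrite card_clique_edges cS; lia.
  case/exists_subset_card => A; rewrite finset.subsetI => /andP[AS AG] cA.
  have Ac : A \in near_cliques n s.
    by rewrite inE cA eqxx; apply/existsP; exists S; rewrite cS eqxx.
  by have := free A Ac; rewrite AG.
pose f : edge_coloring n k.+1 :=
  [ffun e => inord (if e \in G then g e : nat else 0%N)].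
exists f; split.
  case=> S [cS fS]; have /card_gt1P[e1 [e2 []]] := many0 S cS.
  rewrite ![_ \in _ :\: G]in_setD => /andP[/negPf e1G e1S] /andP[/negPf e2G e2S] /eqP; apply.
  by apply: fS => //; rewrite !ffunE e1G e2G.
case=> T [cT]; rewrite /colored_with_at_most leqNgt => /negP[].
(* All [q + 1] colours appear on the edges of [T]. *)
have inj : injective (fun j : 'I_q.+1 => inord j : 'I_k.+1).
  move=> j1 j2 /(congr1 val); rewrite /= !inordK ?(leq_trans (ltn_ord _)) //.
  exact: val_inj.
rewrite -[X in (X <= _)%N]card_ord -(card_codom inj); apply: subset_leq_card.
apply/fintype.subsetP => _ /codomP[j ->]; apply/imsetP.
have [j0|j0] := posnP j.
  (* The common colour already appears on any [s] vertices of [T]. *)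
  have [S ST cS] : exists2 S : {set 'I_n}, S \subset T & #|S| = s.
    by apply: exists_subset_card; rewrite cT.
  have /card_gt1P[e [_ [+ _ _]]] := many0 S cS.
  rewrite [_ \in _ :\: G]in_setD => /andP[/negPf eG eS]; exists e.
    exact: fintype.subsetP (clique_edgesS ST) _ eS.
  by rewrite ffunE eG j0.
have jq : (j.-1 < q)%N by have := ltn_ord j; lia.
(* A rare colour that survives in [T]: the edge lies outside the members of
   [F0] meeting [T], so outside all of [F0]. *)
pose F := F0 :&: touching s T.
have FF : F \in matchings s T.
  by rewrite inE finset.subsetIr (trivIsetS _ tF0) // finset.subsetIl.
have := unm T (Ordinal jq) F cT FF; rewrite inE negb_and => /orP[/negP[]|].
  apply: fintype.subset_trans F0r; apply/bigcupsP => A; rewrite inE => /andP[AF _].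
  exact: bigcup_sup.
rewrite negb_forall => /existsP[e]; rewrite negb_imply negbK /= prednK // => /andP[+ /eqP ge].
rewrite inE => /andP[eF eT]; exists e => //.
rewrite ffunE ifT ?ge // !inE ge j0 -ltnS ltn_ord !andbT.
apply: contra eF => /bigcupP[A AF eA]; apply/bigcupP; exists A => //.
rewrite inE AF inE (fintype.subsetP F0c _ AF) /=.
by apply/set0Pn; exists e; rewrite inE eA.
Qed.
End Recolouring.

(** * Choice of the number of labels *)

(** With [b = 'C(s, 2)] and [u = p ^ 2 / (8 N)]: the edges of [T] contribute at most [- 2 u] to
    the logarithm since ['C(p, 2) >= p ^ 2 / 4], the near-cliques at most [u] by
    the hypothesis on [N ^ (b - 2)], and the choices of [T] and [i] less
    than [u] by the hypothesis on [p]. *)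
Lemma union_bound_lt1 (R : realType) (n q s p N : nat) :
  (2 <= N)%N -> (0 < n)%N -> (0 < q)%N -> (4 <= s)%N -> (2 <= p)%N ->
  8 * 'C(s, 2)%:R * (2 * q%:R) ^+ 'C(s, 2).-1 * n%:R ^+ (s - 2)
    <= N%:R ^+ ('C(s, 2) - 2) :> R ->
  8 * N%:R * (ln n%:R + ln q%:R) < p%:R :> R ->
  q%:R * n%:R ^+ p * ((1 - N%:R^-1) ^+ 'C(p, 2) *
     (1 + (2 * q%:R / N%:R) ^+ ('C(s, 2).-1)) ^+ ('C(s, 2) * (p ^ 2 * n ^ (s - 2))))
    < 1 :> R.
Proof.
move=> N2 n0 q0 s4 p2; set b := 'C(s, 2); move=> Nn Np; set w := _ ^+ b.-1.
have b6 : (6 <= b)%N by apply: (leq_bin2l 2 s4).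
have N0 : 0 < N%:R :> R by rewrite ltr0n; lia.
have w0 : 0 <= w by rewrite exprn_ge0 // divr_ge0 ?mulr_ge0 ?ler0n.
have u0 : 0 <= 1 - N%:R^-1 :> R by rewrite subr_ge0 invf_le1 // ler1n; lia.
have w1 : 0 <= 1 + w by rewrite addr_ge0.
have exprE x y m : 0 <= x -> x <= expR y -> x ^+ m <= expR (y * m%:R) :> R.
  by move=> x0 xy; rewrite expRM_natr; apply: lerXn2r => //; rewrite nnegrE ?expR_ge0.
have natE m : (0 < m)%N -> m%:R <= expR (ln m%:R) :> R.
  by move=> m0; rewrite lnK // posrE ltr0n.
apply: (@le_lt_trans _ _ (expR (ln q%:R) * expR (ln n%:R * p%:R) *
   (expR (- N%:R^-1 * 'C(p, 2)%:R) * expR (w * (b * (p ^ 2 * n ^ (s - 2)))%:R)))).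
  apply: ler_pM; rewrite ?mulr_ge0 ?exprn_ge0 ?ler0n //.
    by apply: ler_pM; rewrite ?exprn_ge0 ?ler0n ?natE // exprE ?ler0n ?natE.
  apply: ler_pM; [exact: exprn_ge0 | exact: exprn_ge0 | |].
    by apply: exprE => //; apply: expR_ge1Dx.
  by apply: exprE => //; apply: expR_ge1Dx.
rewrite -!expRD expR_lt1.
have wle : w * (b * (p ^ 2 * n ^ (s - 2)))%:R <= p%:R ^+ 2 / (8 * N%:R).
  rewrite ler_pdivlMr ?mulr_gt0 // !natrM !natrX.
  rewrite /w expr_div_n -[X in N%:R ^+ X](_ : (b - 2).+1 = _); last lia.
  have Nb : 0 < N%:R ^+ (b - 2) :> R by rewrite exprn_gt0.
  rewrite exprS; set Z := N%:R ^+ (b - 2) in Nn Nb *.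
  rewrite [leLHS](_ : _ = p%:R ^+ 2 * ((8 * b%:R * (2 * q%:R) ^+ b.-1 * n%:R ^+ (s - 2)) / Z)).
    rewrite ler_piMr ?exprn_ge0 ?ler0n // ler_pdivrMr ?mul1r //.
  by field; rewrite !gt_eqF.
have lnq0 : 0 <= ln q%:R :> R by rewrite ln_ge0 // ler1n.
have p1 : 1 <= p%:R :> R by rewrite ler1n; lia.
have logs : ln q%:R + ln n%:R * p%:R < p%:R ^+ 2 / (8 * N%:R) :> R.
  have : ln n%:R + ln q%:R < p%:R / (8 * N%:R) :> R.
    by rewrite ltr_pdivlMr ?mulr_gt0 // mulrC.
  rewrite expr2 -mulrA; set z := p%:R / _ => lt_z; nra.
have pairs : 2 * (p%:R ^+ 2 / (8 * N%:R)) <= N%:R^-1 * 'C(p, 2)%:R :> R.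
  have : (p ^ 2 <= 4 * 'C(p, 2))%N.
    have := bin_ffact p 2; rewrite ffactnS ffactn1 (_ : 2`! = 2)%N //; nia.
  rewrite -(ler_nat R) natrX natrM => pC.
  rewrite [leLHS](_ : _ = N%:R^-1 * (p%:R ^+ 2 / 4)).
    apply: ler_wpM2l; first by rewrite invr_ge0 ltW.
    by rewrite ler_pdivrMr // mulrC.
  by field; rewrite gt_eqF.
by rewrite mulNr; lra.
Qed.

(** Taking [N] just above [K * n ^ a], with [b = 'C(s, 2)] and
    [K = 8 b (2q) ^ (b - 1)] the constant of [union_bound_lt1], works because [K >= 1] and [(s - 2) <= a (b - 2)] give
    [N ^ (b - 2) >= K ^ (b - 2) n ^ (a (b - 2)) >= K n ^ (s - 2)]. *)
Lemma colouring_of_log_bound (R : realType) (n s q k p : nat) (a : R) :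
  (4 <= s)%N -> (0 < q)%N -> (q < k)%N -> (s <= p)%N -> (0 < n)%N ->
  0 < a -> s%:R - 2 <= a * ('C(s, 2)%:R - 2) ->
  16 * (8 * 'C(s, 2)%:R * (2 * q%:R) ^+ 'C(s, 2).-1) * n%:R `^ a
    * (ln n%:R + ln q%:R) < p%:R ->
  exists f : edge_coloring n k,
    ~ has_rainbow_clique f s /\ ~ has_colored_clique f q p.
Proof.
move=> s4 q0 qk sp n0 a0 ab; set b := 'C(s, 2); set K := 8 * _ * _ => np.
have b6 : (6 <= b)%N by apply: (leq_bin2l 2 s4).
have q1 : 1 <= q%:R :> R by rewrite ler1n.
have n1 : 1 <= n%:R :> R by rewrite ler1n.
have b1 : 1 <= b%:R :> R by rewrite ler1n; lia.
have K8q : 8 * q%:R <= K.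
  rewrite /K -mulrA ler_pM2l //.
  have qP : 2 * q%:R <= (2 * q%:R) ^+ b.-1 :> R by rewrite ler_eXnr //; [lia | lra].
  have P0 : 0 <= (2 * q%:R) ^+ b.-1 :> R by lra.
  have := ler_peMl P0 b1; lra.
have na1 : 1 <= n%:R `^ a by have := ler_powR n1 (ltW a0); rewrite powRr0.
have K1 : 8 <= K by lra.
have K1' : 1 <= K by lra.
have b2' : (2 <= b)%N by apply: leq_trans b6.
have b2 : (0 < b - 2)%N by rewrite subn_gt0; apply: leq_trans b6.
pose N := (Num.trunc (K * n%:R `^ a)).+1.
have Kn0 : 0 <= K * n%:R `^ a by rewrite mulr_ge0 ?powR_ge0 //; lra.
have ltN : K * n%:R `^ a < N%:R by apply: truncnS_gt.
have leN : N%:R <= 2 * K * n%:R `^ a.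
  have : N%:R <= K * n%:R `^ a + 1 by rewrite -natr1 lerD2r truncn_le.
  have := mulr_ege1 K1' na1; lra.
have KN : K < N%:R by apply: le_lt_trans ltN; apply: ler_peMr; lra.
have qN : (q < N)%N by rewrite -(ltr_nat R); lra.
have N2 : (2 <= N)%N by rewrite -(ler_nat R); lra.
have lnq0 : 0 <= ln q%:R :> R by rewrite ln_ge0.
have lnn0 : 0 <= ln n%:R :> R by rewrite ln_ge0.
have s3 : (3 <= s)%N by apply: ltnW.
have p2 : (2 <= p)%N by apply: leq_trans sp; apply: ltnW.
have KnN : K * n%:R ^+ (s - 2) <= N%:R ^+ (b - 2).
  apply: (@le_trans _ _ ((K * n%:R `^ a) ^+ (b - 2))).
    rewrite exprMn; apply: ler_pM; first by lra.
    - by apply: exprn_ge0; apply: ler0n.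
    - exact: ler_eXnr b2 K1'.
    rewrite -!powR_mulrn ?powR_ge0 // -powRrM ler_powR //.
    by rewrite (natrB R (ltnW s3)) (natrB R b2').
  by apply: lerXn2r; rewrite ?nnegrE ?ler0n // ltW.
have Np : 8 * N%:R * (ln n%:R + ln q%:R) < p%:R :> R.
  apply: le_lt_trans np; apply: ler_wpM2r; first exact: addr_ge0.
  lra.
have [g unm] := exists_unmissed qN N2 s3 (union_bound_lt1 N2 n0 q0 s4 p2 KnN Np).
exact: colouring_of_unmissed s3 sp qk unm.
Qed.

(** * Asymptotics *)

Local Open Scope classical_set_scope.

(** From [ln y = 2 ln (sqrt y) <= 2 sqrt y], which is at most [y / M] once
    [sqrt y >= 2 M]. *)
Lemma near_ln_le (R : realType) (lam M : R) : 0 < lam -> 0 <= M ->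
  \forall p \near \oo, M * ln (p%:R * lam) <= p%:R * lam.
Proof.
move=> lam0 M0; near=> p.
have pl : 4 * M ^+ 2 + 1 <= p%:R * lam.
  by rewrite -ler_pdivrMr //; near: p; apply: nbhs_infty_ger.
set y := p%:R * lam in pl *.
have y0 : 0 < y by nra.
have r0 : 0 < Num.sqrt y by rewrite sqrtr_gt0.
have ry : Num.sqrt y ^+ 2 = y by rewrite sqr_sqrtr // ltW.
have := ln_sublinear r0; have := lnXn 2 r0; rewrite ry -mulr_natl => lnE lnr.
have : 2 * M <= Num.sqrt y.
  by rewrite -[leLHS]ger0_norm ?mulr_ge0 // -sqrtr_sqr ler_sqrt //; nra.
move=> Mr; nra.
Unshelve. all: by end_near.
Qed.

(** Rounding [X ^ (1/a)] down to [n] changes [X] by a factor at most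
    [(1 + 1/n) ^ a], and [a <= 1] bounds this by [1 + 1/n].  The last bound makes
    [n] tend to infinity with [X]. *)
Lemma powR_truncn (R : realType) (a X : R) (n := Num.trunc (X `^ a^-1)) :
  0 < a -> a <= 1 -> 2 <= X ->
  [/\ (0 < n)%N, n%:R `^ a <= X, X <= n%:R `^ a * (1 + n%:R^-1) & X - 1 <= n%:R].
Proof.
move=> a0 a1 X2; have X0 : 0 <= X by lra.
have Y0 : 0 <= X `^ a^-1 by apply: powR_ge0.
have YX : (X `^ a^-1) `^ a = X by rewrite -powRrM mulVf ?gt_eqF // powRr1.
have XY : X <= X `^ a^-1 by apply: le1r_powR; [lra | rewrite invf_ge1].
have nY : n%:R <= X `^ a^-1 by rewrite truncn_le.
have Yn : X `^ a^-1 < n%:R + 1 by rewrite natr1; apply: truncnS_gt.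
have n1 : 1 <= n%:R :> R by rewrite ler1n truncn_gt0; lra.
have n0 : 0 < n%:R :> R by lra.
have nV : 0 < n%:R^-1 :> R by rewrite invr_gt0.
split; first by rewrite -(ltr_nat R).
- rewrite -[leRHS]YX; apply: ge0_ler_powR; rewrite ?nnegrE //; lra.
- rewrite -[leLHS]YX.
  apply: (@le_trans _ _ ((n%:R * (1 + n%:R^-1)) `^ a)).
    apply: ge0_ler_powR; [exact: ltW | by rewrite nnegrE | | ].
      by rewrite nnegrE; apply: mulr_ge0; lra.
    by rewrite mulrDr mulr1 divff ?gt_eqF // ltW.
  rewrite powRM //; apply: ler_wpM2l; first exact: powR_ge0.
  by apply: ler1_powR; lra.
- lra.
Qed.

Lemma L_gt0 (R : realType) (s k : nat) :
  (2 <= s)%N -> (2 <= k)%N -> ('C(s, 2) <= k)%N -> 0 < L R s k.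
Proof.
move=> s2 k2 bk; rewrite /L !mulr_gt0 //.
- by rewrite ltr0n bin_gt0.
- by rewrite exprz_gt0 // subr_gt0 ltr1n.
rewrite big_nat_cond; apply: prodr_gt0 => i; rewrite andbT => /andP[_ ib].
by rewrite subr_gt0 ltr_nat (leq_trans ib).
Qed.

Theorem proposition1p5 (R : realType) (s q k : nat) (hs : (4 <= s)%N)
    (hq : (0 < q)%N) (hk : (0 < k)%N)
    (hsqk : (maxn 'C(s, 2) (2 * q + 1) <= k)%N) :
  exists c : R, 0 < c /\
  exists eps : nat -> R, eps p @[p --> \oo] --> (0 : R) /\
  \forall p \near \oo,
    let pL : R := p%:R * L R s k `^ (1 / (1 - 'C(s, 2)%:R)) in
    let m : R := 'C(s, 2)%:R - 21 / 10 in
    exists n : nat, (0 < n)%N /\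
      n%:R = ((s%:R - 2) * pL / ((c + eps p) * m * ln pL)) `^ (m / (s%:R - 2)) /\
      exists f : edge_coloring n k,
        ~ has_rainbow_clique f s /\ ~ has_colored_clique f q p.
Proof.
have b6 : (6 <= 'C(s, 2))%N by apply: (leq_bin2l 2 hs).
have bs : (s + 2 <= 'C(s, 2))%N.
  have := bin_ffact s 2; rewrite ffactnS ffactn1 (_ : 2`! = 2)%N //; nia.
have [bk qk] : ('C(s, 2) <= k)%N /\ (q < k)%N by move: hsqk; rewrite geq_max; lia.
have Lpos : 0 < L R s k by apply: L_gt0; lia.
set b := 'C(s, 2) in b6 bs bk *.
have b6R : 6 <= b%:R :> R by rewrite (ler_nat R 6).
have bsR : s%:R + 2 <= b%:R :> R by rewrite -natrD ler_nat.
have s4R : 4 <= s%:R :> R by rewrite (ler_nat R 4).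
set lam := L R s k `^ _; have lam0 : 0 < lam by apply: powR_gt0.
clearbody lam; move=> {Lpos}.
pose m : R := b%:R - 21 / 10; have m0 : 0 < m by rewrite /m; lra.
pose a : R := (s%:R - 2) / m.
have a0 : 0 < a by rewrite divr_gt0 //; lra.
have a1 : a <= 1 by rewrite ler_pdivrMr // /m; lra.
have am : a * m = s%:R - 2 by rewrite divfK ?gt_eqF.
have aV : m / (s%:R - 2) = a^-1 by rewrite invf_div.
pose K : R := 8 * b%:R * (2 * q%:R) ^+ b.-1.
have q0R : 0 < q%:R :> R by rewrite ltr0n.
have K0 : 0 < K by apply: mulr_gt0; [lra | apply: exprn_gt0; lra].
pose D : R := a * lam; have D0 : 0 < D by rewrite mulr_gt0.
have aV0 : 0 < a^-1 by rewrite invr_gt0.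
(* The first summand of [c] beats the constant of [colouring_of_log_bound];
   the second one makes [X p <= p * lam] below, so that
   [ln n <= a^-1 * ln (p * lam)]. *)
pose c : R := 16 * K * (a^-1 + 1) * D + D / lam.
have Dl0 : 0 < D / lam by rewrite divr_gt0.
have c0' : 0 < 16 * K * (a^-1 + 1) * D by apply: mulr_gt0 => //; apply: mulr_gt0; lra.
have c0 : 0 < c by rewrite addr_gt0.
have cl : D / lam <= c by rewrite /c; lra.
have cK : 16 * K * (a^-1 + 1) * D < c by rewrite /c; lra.
clearbody c; exists c; split=> //.
(* [X p] is the base of the power when [eps p = 0]. *)
pose X p : R := D * p%:R / (c * ln (p%:R * lam)).
pose n p := Num.trunc (X p `^ a^-1).
have ln_near M : \forall p \near \oo, M <= ln (p%:R * lam).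
  near=> p; rewrite -ler_expR lnK ?posrE.
    by rewrite -ler_pdivrMr //; near: p; apply: nbhs_infty_ger.
  by rewrite mulr_gt0 // ltr0n; near: p; apply: nbhs_infty_gt.
have X_near M : 0 <= M -> \forall p \near \oo, M <= X p.
  move=> M0; near=> p.
  have l1 : 1 <= ln (p%:R * lam) by near: p; apply: ln_near.
  have : M * c * lam / D * ln (p%:R * lam) <= p%:R * lam.
    near: p; apply: near_ln_le => //.
    by apply: divr_ge0; [apply: mulr_ge0; [apply: mulr_ge0|] |]; rewrite // ltW.
  rewrite /X ler_pdivlMr ?mulr_gt0 //; last by lra.
  set l := ln _ => /(ler_wpM2l (ltW D0)).
  have -> : D * (M * c * lam / D * l) = lam * (M * (c * l)).
    by field; rewrite gt_eqF.
  have -> : D * (p%:R * lam) = lam * (D * p%:R) by ring.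
  by rewrite ler_pM2l.
(* Chosen so that the base is exactly [n ^ a]. *)
pose eps p := c * (X p / (n p)%:R `^ a) - c.
exists eps; split.
  apply/cvgrPdist_le => e e0; near=> p.
  have X2 : 2 <= X p by near: p; apply: X_near.
  have Xe : c / e + 1 <= X p.
    by near: p; apply: X_near; rewrite addr_ge0 // divr_ge0 // ltW.
  have [n0 naX Xna Xn] := powR_truncn a0 a1 X2.
  rewrite -/(n p) in n0 naX Xna Xn.
  have n0R : 0 < (n p)%:R :> R by rewrite ltr0n.
  have na0 : 0 < (n p)%:R `^ a by apply: powR_gt0.
  have r1 : 1 <= X p / (n p)%:R `^ a by rewrite ler_pdivlMr // mul1r.
  have r2 : X p / (n p)%:R `^ a <= 1 + (n p)%:R^-1 by rewrite ler_pdivrMr // mulrC.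
  have cn : c * (n p)%:R^-1 <= e.
    by rewrite ler_pdivrMr // mulrC -ler_pdivrMr //; lra.
  rewrite sub0r normrN ger0_norm /eps; last by rewrite subr_ge0 ler_peMr // ltW.
  have := ler_wpM2l (ltW c0) r2; rewrite mulrDr mulr1 => cr2.
  by rewrite lerBlDl (le_trans cr2) // lerD2l.
near=> p; rewrite -/m.
have X2 : 2 <= X p by near: p; apply: X_near.
have l1 : 1 <= ln (p%:R * lam) by near: p; apply: ln_near.
have lq : ln q%:R <= ln (p%:R * lam) by near: p; apply: ln_near.
have sp : (s <= p)%N by near: p; apply: nbhs_infty_ge.
have p0 : 0 < p%:R :> R by rewrite ltr0n (leq_trans _ sp) // (leq_trans _ hs).
set pL := p%:R * lam in l1 lq *; have pL0 : 0 < pL by rewrite mulr_gt0.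
have [n0 naX Xna Xn] := powR_truncn a0 a1 X2.
rewrite -/(n p) in n0 naX Xna Xn.
have n0R : 0 < (n p)%:R :> R by rewrite ltr0n.
have na0 : 0 < (n p)%:R `^ a by apply: powR_gt0.
have XE : X p * (c * ln pL) = D * p%:R.
  by rewrite /X divfK // mulf_neq0 ?gt_eqF //; lra.
exists (n p); split=> //; split.
  rewrite aV (_ : _ / _ = (n p)%:R `^ a).
    by rewrite -powRrM mulfV ?gt_eqF // powRr1 // ltW.
  have XX : X p != 0 by rewrite gt_eqF //; lra.
  have lX : ln pL != 0 by rewrite gt_eqF //; lra.
  have -> : c + eps p = c * (X p / (n p)%:R `^ a) by rewrite /eps addrC subrK.
  have -> : (s%:R - 2) * pL = m * (X p * (c * ln pL)).
    by rewrite XE -am /D /pL; ring.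
  by field; rewrite XX lX !gt_eqF.
have XpL : X p <= pL.
  have : X p * c <= X p * (c * ln pL) by rewrite mulrA ler_peMr // mulr_ge0 //; lra.
  rewrite XE => h.
  rewrite -(ler_pM2r c0) (le_trans h) // /pL.
  by move: cl; rewrite ler_pdivrMr // => /(ler_wpM2l (ltW p0)); lra.
apply: (@colouring_of_log_bound R _ s q k p a) => //.
  rewrite -am -/b -/m; apply: ler_wpM2l; [lra | rewrite /m; lra].
rewrite -/b -/K.
have lnn : ln (n p)%:R <= a^-1 * ln pL.
  rewrite mulrC ler_pdivlMr // mulrC -ln_powR ler_ln ?posrE //.
  exact: le_trans naX XpL.
have lnq0 : 0 <= ln q%:R :> R by rewrite ln_ge0 // ler1n.
have lnn0 : 0 <= ln (n p)%:R :> R by rewrite ln_ge0 // ler1n.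
apply: (@le_lt_trans _ _ (16 * K * X p * ((a^-1 + 1) * ln pL))).
  have K16 : 0 <= 16 * K by apply: mulr_ge0 => //; apply: ltW.
  apply: ler_pM; [|exact: addr_ge0|exact: ler_wpM2l|].
    by apply: mulr_ge0 => //; apply: powR_ge0.
  by rewrite mulrDl mul1r; apply: lerD.
rewrite -(ltr_pM2r c0).
have -> : 16 * K * X p * ((a^-1 + 1) * ln pL) * c
   = 16 * K * (a^-1 + 1) * (X p * (c * ln pL)) by ring.
by rewrite XE mulrA mulrC ltr_pM2l.
Unshelve. all: by end_near.
Qed.
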